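(* If all of the series below converge, then $$\left(x+\tfrac{y-1}{2}\right){}_{6}F_{5}\!\left[\begin{matrix}x,\,x,\,x,\,x,\,x+\frac{y+1}{2},\,1\\ x+y,\,x+y,\,x+y,\,x+y,\,x+\frac{y-1}{2}\end{matrix}\,\Bigg|\,1\right]=x+\tfrac{y-1}{2}+\frac{x^4}{(x+y)^4}\left(x+1+\tfrac{y-1}{2}\right){}_{6}F_{5}\!\left[\begin{matrix}x+1,\,x+1,\,x+1,\,x+1,\,x+1+\frac{y+1}{2},\,1\\ x+1+y,\,x+1+y,\,x+1+y,\,x+1+y,\,x+1+\frac{y-1}{2}\end{matrix}\,\Bigg|\,1\right]$$ and $$\left(x+\tfrac{y-1}{2}\right){}_{6}F_{5}\!\left[\begin{matrix}x,\,x,\,x,\,x,\,x+\frac{y+1}{2},\,1\\ x+y,\,x+y,\,x+y,\,x+y,\,x+\frac{y-1}{2}\end{matrix}\,\Bigg|\,1\right]=\frac{5y^2+6(x-1)y+2(x-1)^2}{4(2y-1)}-\frac{y^5}{2(2y-1)(x+y)^4}\left(x+\tfrac{y}{2}\right){}_{6}F_{5}\!\left[\begin{matrix}x,\,x,\,x,\,x,\,x+\frac{y+2}{2},\,1\\ x+y+1,\,x+y+1,\,x+y+1,\,x+y+1,\,x+\frac{y}{2}\end{matrix}\,\Bigg|\,1\right].$$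
   Context: ${}_{p}F_{q}\!\left[\begin{matrix}a_1,\dots,a_p\\ b_1,\dots,b_q\end{matrix}\,\Big|\,z\right]=\sum_{k=0}^{\infty}\frac{(a_1)_k\cdots(a_p)_k}{(b_1)_k\cdots(b_q)_k}\frac{z^k}{k!}$ is the generalized hypergeometric series, where $(a)_k=a(a+1)\cdots(a+k-1)$. *)

(* Defs.v *)
From HB Require Import structures.
From mathcomp Require Import all_boot all_order all_algebra.
From mathcomp Require Import complex.
From mathcomp Require Import boolp classical_sets reals topology normedtype.
From mathcomp Require Import sequences.
Set Implicit Arguments.
Unset Strict Implicit.
Unset Printing Implicit Defensive.
Import Order.TTheory GRing.Theory Num.Theory.
Import numFieldNormedType.Exports.

Local Open Scope classical_set_scope.
Local Open Scope ring_scope.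

Definition poch (R : realType) (a : R[i]) (k : nat) : R[i] :=
  \prod_(j < k) (a + j%:R).

(* [a] and [b] list the upper and the lower parameters.  The factor k! is
   always present, so a parameter 1 in [a] is a genuine upper parameter. *)
Definition pFq_term (R : realType) (a b : seq R[i]) (z : R[i]) (k : nat)
    : R[i] :=
  (\prod_(c <- a) poch c k) / (\prod_(c <- b) poch c k) * (z ^+ k / k`!%:R).

(* [R[i]^o] is [R[i]] carrying the topology of the complex modulus. *)
Definition pFq_partial_sums (R : realType) (a b : seq R[i]) (z : R[i])
    : nat -> R[i]^o :=
  series (pFq_term a b z : nat -> R[i]^o).

(* Convergence includes that every term is defined: MathComp division is total
   (x / 0 = 0), so nonpositive integer lower parameters are excluded by hand. *)
Definition pFq_converges (R : realType) (a b : seq R[i]) (z : R[i]) : Prop :=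
  (forall c, c \in b -> forall n : nat, c != - n%:R)
  /\ cvgn (pFq_partial_sums a b z).

(* Meaningful only under [pFq_converges a b z]. *)
Definition pFq (R : realType) (a b : seq R[i]) (z : R[i]) : R[i] :=
  limn (pFq_partial_sums a b z).

(* Main.v *)
(** With [u_k = ((x)_k / (x + y)_k)^4] and [c = x + (y - 1)/2], the left-hand
    series is [sum a_k] with [a_k = u_k (c + k)]; shifting the index gives the
    first identity.  For the second, let
    [G t = (5 y^2 + 6 (t - 1) y + 2 (t - 1)^2) / (4 (2 y - 1))].  The difference
    of the [k]-th terms of the two sides telescopes as
    [u_k G(x + k) - u_(k+1) G(x + k + 1)], so [u_n G(x + n)] has a limit [L].
    As [G] is quadratic, [n a_n] tends to [2 (2 y - 1) L], and this limit must
    vanish, since otherwise [sum a_k] would diverge like the harmonic series. *)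
Require Import Defs.
From HB Require Import structures.
From mathcomp Require Import all_boot all_order all_algebra.
From mathcomp Require Import complex.
From mathcomp Require Import boolp classical_sets reals topology normedtype.
From mathcomp Require Import sequences.
From mathcomp Require Import ring.
Import Order.TTheory GRing.Theory Num.Theory.
Import numFieldNormedType.Exports.
Local Open Scope classical_set_scope.
Local Open Scope ring_scope.

(** If [M] were nonzero, Cauchy's criterion would bound the block sum of [a k] over [n <= k < 2n] by
    |M|/4. On that block [a k] lies within |M|/(2k) of M/k, and the sum [h] of the 1/k is at least
    1/2; together these force [h < 1/2]. *)
Lemma cvg_series_mulrn_cvg0 (K : numFieldType) (a : nat -> K^o) (M : K^o) :
  cvgn (series a) ->
  (fun n => n%:R * a n : K^o) @ \oo --> M ->
  M = 0.
Proof.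
move=> cva cvM; apply/eqP/negPn/negP => M0.
have M4 : 0 < `|M| / 4 by rewrite divr_gt0 ?normr_gt0.
have M2 : 0 < `|M| / 2 by rewrite divr_gt0 ?normr_gt0.
have /cvgrPdist_lt /(_ _ M2) [N1 _ HN1] := cvM.
have [l cvl] : exists l : K^o, series a @ \oo --> l.
  by exists (limn (series a)).
have M8 : 0 < `|M| / 4 / 2 by rewrite divr_gt0.
have /cvgrPdist_lt /(_ _ M8) [N2 _ HN2] := cvl.
(* The successor keeps [n] positive, so every index of the block can be inverted. *)
pose n := (N1 + N2).+1.
have n1 : (N1 <= n)%N by rewrite /n ltnW // ltnS leq_addr.
have n2 : (N2 <= n)%N by rewrite /n ltnW // ltnS leq_addl.
have nn : (n <= n + n)%N by rewrite leq_addr.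
have small : `|\sum_(n <= k < n + n) a k| < `|M| / 4.
  rewrite -sub_series_geq // (splitr (`|M| / 4)).
  have -> : series a (n + n)%N - series a n
      = (l - series a n) - (l - series a (n + n)%N) by ring.
  rewrite (le_lt_trans (ler_normB _ _)) // ltrD //; apply: HN2 => //=.
  exact: leq_trans nn.
pose h : K := \sum_(n <= k < n + n) k%:R^-1.
have h2 : 2^-1 <= h.
  have -> : 2^-1 = \sum_(n <= k < n + n) (n + n)%:R^-1 :> K.
    rewrite sumr_const_nat addnK natrD -mulr_natl.
    by field; rewrite -natrD pnatr_eq0.
  rewrite /h !big_nat; apply: ler_sum => k /andP[nk kn].
  rewrite lef_pV2 ?posrE ?ltr0n ?(leq_trans _ nk) ?addn_gt0 //.
  by rewrite ler_nat ltnW.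
have close : `|M * h - \sum_(n <= k < n + n) a k| <= `|M| / 2 * h.
  rewrite /h !mulr_sumr -sumrB (le_trans (ler_norm_sum _ _ _)) //.
  rewrite !big_nat; apply: ler_sum => k /andP[nk kn].
  have k0 : 0 < k%:R :> K by rewrite ltr0n (leq_trans _ nk).
  have -> : M / k%:R - a k = (M - k%:R * a k) / k%:R.
    by field; rewrite gt_eqF.
  rewrite normrM normfV (gtr0_norm k0) ler_pM2r ?invr_gt0 //.
  by apply/ltW/HN1 => /=; exact: leq_trans nk.
have h0 : 0 <= h by rewrite (le_trans _ h2) // invr_ge0.
have : `|M * h| < `|M| / 2 * h + `|M| / 4.
  rewrite -[M * h](subrK (\sum_(n <= k < n + n) a k)).
  by rewrite (le_lt_trans (ler_normD _ _)) // ler_ltD.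
rewrite normrM (ger0_norm h0) -subr_gt0.
have -> : `|M| / 2 * h + `|M| / 4 - `|M| * h = `|M| / 2 * (2^-1 - h) by field.
by rewrite pmulr_rgt0 // subr_gt0 => /lt_le_trans /(_ h2); rewrite ltxx.
Qed.

Section Pochhammer.
Variable R : realType.
Implicit Types (a b c z : R[i]) (n k : nat).

Lemma poch0 a : poch a 0 = 1.
Proof. by rewrite /poch big_ord0. Qed.

Lemma pochS a k : poch a k.+1 = poch a k * (a + k%:R).
Proof. by rewrite /poch big_ord_recr. Qed.

Lemma pochSl a k : poch a k.+1 = a * poch (a + 1) k.
Proof.
rewrite /poch big_ord_recl addr0; congr (_ * _); apply: eq_bigr => i _.
by rewrite /= -natr1 (addrC i%:R) addrA.
Qed.

Lemma poch1 k : poch (1 : R[i]) k = k`!%:R.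
Proof.
elim: k => [|k IH]; first by rewrite poch0.
by rewrite pochS IH factS natrM -natr1 mulrC addrC.
Qed.

Lemma poch_neq0 a k : (forall n, a != - n%:R) -> poch a k != 0.
Proof. by move=> a0; apply/prodf_neq0 => i _; rewrite addr_eq0. Qed.

(** The general term common to the three series of the theorem, once each is multiplied by its last
    lower parameter [c]. *)
Definition shifted_quartic a b c k : R[i]^o :=
  (poch a k / poch b k) ^+ 4 * (c + k%:R).

(* The pair (c + 1; c) contributes (c + 1)_k / (c)_k = (c + k) / c. *)
Lemma pFq_cvg a b c c' : c' = c + 1 ->
  pFq_converges [:: a; a; a; a; c'; 1] [:: b; b; b; b; c] 1 ->
  series (shifted_quartic a b c) @ \oo -->
    (c * pFq [:: a; a; a; a; c'; 1] [:: b; b; b; b; c] 1 : R[i]^o).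
Proof.
move=> -> [hb hcv].
have b0 k : poch b k != 0 by apply/poch_neq0/hb; rewrite inE eqxx.
have cn : forall n, c != - n%:R by apply: hb; rewrite !inE eqxx !orbT.
have c0 : c != 0 by have := cn 0%N; rewrite oppr0.
have -> : series (shifted_quartic a b c) =
  (fun n => c * pFq_partial_sums [:: a; a; a; a; c + 1; 1]
                  [:: b; b; b; b; c] 1 n : R[i]^o).
  apply/funext => n; rewrite /pFq_partial_sums /series /= mulr_sumr.
  apply: eq_bigr => k _; rewrite /shifted_quartic /pFq_term.
  rewrite !big_cons !big_nil poch1 expr1n.
  have : c * poch (c + 1) k = poch c k * (c + k%:R) by rewrite -pochSl pochS.
  move/(canRL (mulKf c0)) => ->.
  field; rewrite c0 b0 (poch_neq0 _ _ cn) pnatr_eq0 -lt0n fact_gt0 //.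
by apply: cvgMl_tmp; exact: hcv.
Qed.

(** Lets [u n] be dominated by [u n * (c + n)] for large [n]. *)
Lemma exists_norm_addrn_ge1 c :
  exists N, forall n, (N <= n)%N -> 1 <= `|c + n%:R|.
Proof.
have [N HN] : exists N, `|c| <= N%:R.
  (* The norm on [R[i]] is itself [R[i]]-valued, so the Archimedean bound is taken in [R], on its
     real part. *)
  exists (Num.bound `|complex.Re `|c| |).
  have -> : `|c| = ((complex.Re `|c|)%:C)%C by rewrite RRe_real // normr_real.
  rewrite -(rmorph_nat (real_complex R)) lecR ltW //.
  by rewrite (le_lt_trans (ler_norm _)) // archi_boundP.
exists N.+1 => n Nn.
have : n%:R - `|c| <= `|c + n%:R|.
  by rewrite -[X in X - _]normr_nat (addrC c) lerB_normD.
apply: le_trans; rewrite lerBrDr (le_trans (lerD (lexx _) HN)) //.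
by rewrite nat1r ler_nat.
Qed.

End Pochhammer.

Theorem theorem11 (R : realType) (x y : R[i])
  (h1 : pFq_converges
          [:: x; x; x; x; x + (y + 1) / 2; 1]
          [:: x + y; x + y; x + y; x + y; x + (y - 1) / 2] 1)
  (h2 : pFq_converges
          [:: x + 1; x + 1; x + 1; x + 1; x + 1 + (y + 1) / 2; 1]
          [:: x + 1 + y; x + 1 + y; x + 1 + y; x + 1 + y;
              x + 1 + (y - 1) / 2] 1)
  (h3 : pFq_converges
          [:: x; x; x; x; x + (y + 2) / 2; 1]
          [:: x + y + 1; x + y + 1; x + y + 1; x + y + 1; x + y / 2] 1) :
  (x + (y - 1) / 2)
    * pFq [:: x; x; x; x; x + (y + 1) / 2; 1]
          [:: x + y; x + y; x + y; x + y; x + (y - 1) / 2] 1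
  = x + (y - 1) / 2
    + x ^+ 4 / (x + y) ^+ 4 * (x + 1 + (y - 1) / 2)
      * pFq [:: x + 1; x + 1; x + 1; x + 1; x + 1 + (y + 1) / 2; 1]
            [:: x + 1 + y; x + 1 + y; x + 1 + y; x + 1 + y;
                x + 1 + (y - 1) / 2] 1
  /\
  (2 * y - 1 != 0 ->
  (x + (y - 1) / 2)
    * pFq [:: x; x; x; x; x + (y + 1) / 2; 1]
          [:: x + y; x + y; x + y; x + y; x + (y - 1) / 2] 1
  = (5 * y ^+ 2 + 6 * (x - 1) * y + 2 * (x - 1) ^+ 2) / (4 * (2 * y - 1))
    - y ^+ 5 / (2 * (2 * y - 1) * (x + y) ^+ 4) * (x + y / 2)
      * pFq [:: x; x; x; x; x + (y + 2) / 2; 1]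
            [:: x + y + 1; x + y + 1; x + y + 1; x + y + 1; x + y / 2] 1).
Proof.
set c := x + (y - 1) / 2.
have b0 k : poch (x + y) k != 0.
  by apply: poch_neq0; apply: h1.1; rewrite inE eqxx.
have xy0 : x + y != 0 by have := h1.1 (x + y) (mem_head _ _) 0%N; rewrite oppr0.
have b1 k : x + y + k%:R != 0.
  by rewrite addr_eq0; apply: h1.1; rewrite inE eqxx.
(* Expresses the third series through the Pochhammer symbols of the first, so that their terms can
   be compared rationally. *)
have bS k : poch (x + y + 1) k = poch (x + y) k * (x + y + k%:R) / (x + y).
  by rewrite -pochS pochSl; field.
have e1 : x + (y + 1) / 2 = c + 1 by rewrite /c; field.
have e2 : x + 1 + (y + 1) / 2 = x + 1 + (y - 1) / 2 + 1 by field.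
have e3 : x + (y + 2) / 2 = x + y / 2 + 1 by field.
have := pFq_cvg _ _ _ _ _ e3 h3; have := pFq_cvg _ _ _ _ _ e2 h2.
have := pFq_cvg _ _ _ _ _ e1 h1.
rewrite -/c.
set S1 := c * _; set S2 := _ * pFq _ _ _; set S3 := _ * pFq _ _ _.
move=> cv1 cv2 cv3.
split.
  rewrite -mulrA -/S2.
  (* The term of index 0 is [c]; in the later ones (x)_(k+1) = x (x+1)_k, and likewise for x + y,
     release the factor x^4/(x+y)^4. *)
  have E n : series (shifted_quartic R x (x + y) c) n.+1 =
     c + x ^+ 4 / (x + y) ^+ 4 *
         series (shifted_quartic R (x + 1) (x + 1 + y) (x + 1 + (y - 1) / 2)) n.
    rewrite /series /= big_nat_recl // mulr_sumr; congr (_ + _).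
      by rewrite /shifted_quartic !poch0 divr1 expr1n mul1r addr0.
    apply: eq_bigr => k _; rewrite /shifted_quartic !pochSl (addrAC x 1 y).
    rewrite -natr1 /c; set p := poch _ _; set q := poch _ _.
    have q0 : q != 0 by rewrite /q bS !mulf_neq0 ?invr_eq0.
    by field; rewrite q0 xy0.
  have cvS : (fun n => series (shifted_quartic R x (x + y) c) n.+1) @ \oo -->
      (S1 : R[i]^o) by rewrite cvg_shiftS; exact: cv1.
  apply: (norm_cvg_unique cvS); rewrite (funext E).
  apply: (@cvgD R[i] R[i]^o); first exact: cvg_cst.
  by apply: (@cvgMl_tmp R[i]); exact: cv2.
move=> y0.
pose u k := (poch x k / poch (x + y) k) ^+ 4.
pose G (t : R[i]) := (5 * y ^+ 2 + 6 * (t - 1) * y + 2 * (t - 1) ^+ 2)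
                / (4 * (2 * y - 1)).
pose w := y ^+ 5 / (2 * (2 * y - 1) * (x + y) ^+ 4).
rewrite -/(G x) -/w -[w * _ * _]mulrA -/S3.
set a := shifted_quartic _ _ _ _ in cv1; set d := shifted_quartic _ _ _ _ in cv3.
have tele n : series a n = G x - w * series d n - u n * G (x + n%:R).
  elim: n => [|n IH].
    by rewrite /series /= !big_geq // /u !poch0 divr1 expr1n addr0; ring.
  rewrite !seriesSr IH /a /d /u /shifted_quartic bS !pochS /G /w /c -[n.+1%:R]natr1.
  (* With the Pochhammer symbols and [n] made independent variables, the telescoping step is an
     identity of rational functions. *)
  move: (b0 n) (b1 n); move: (poch x n) (poch (x + y) n) (n%:R) => p q t q0 t0.
  by field; rewrite q0 t0 xy0 y0.
(* The second identity says exactly that [L = 0]. *)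
pose L := G x - w * S3 - S1.
have cvL : (fun n => u n * G (x + n%:R) : R[i]^o) @ \oo --> (L : R[i]^o).
  rewrite (_ : (fun _ => _) = (fun n => G x - w * series d n - series a n)).
    apply: (@cvgB R[i] R[i]^o); last exact: cv1.
    apply: (@cvgB R[i] R[i]^o); first exact: cvg_cst.
    by apply: (@cvgMl_tmp R[i]); exact: cv3.
  by apply/funext => n; rewrite tele; ring.
have cva1 : cvgn (series (a : nat -> R[i]^o)) by exact: cvgP cv1.
have cva : a @ \oo --> (0 : R[i]^o).
  exact: (@cvg_series_cvg_0 R[i] R[i]^o).
(* No asymptotics of Pochhammer symbols are needed: |u n| <= |a n| as soon as |c + n| >= 1. *)
have cvu : (u : nat -> R[i]^o) @ \oo --> (0 : R[i]^o).
  have [N HN] := exists_norm_addrn_ge1 R c.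
  apply/cvgr0Pnorm_lt => e e0; have /cvgr0Pnorm_lt /(_ _ e0) := cva.
  apply: filterS2 (nbhs_infty_ge N) => n /= Nn; apply: le_lt_trans.
  have -> : a n = u n * (c + n%:R) by [].
  by rewrite [X in _ <= X]normrM ler_peMr ?HN.
(* Quotient and remainder, as polynomials in [n], of 2(2y-1) G(x+n) - n(c+n) on division by c + n;
   the two corrections in [na] thus become multiples of [a n] and [u n], which tend to 0. *)
pose k1 := x + (5 * y - 3) / 2; pose k2 := (5 * y ^+ 2 - 4 * y + 1) / 4.
have na n : n%:R * a n =
    2 * (2 * y - 1) * (u n * G (x + n%:R)) - k1 * a n - k2 * u n.
  have -> : a n = u n * (c + n%:R) by [].
  move: (u n) (n%:R) => v t; rewrite /G /c /k1 /k2.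
  by field.
have M0 : 2 * (2 * y - 1) * L - k1 * 0 - k2 * 0 = 0.
  apply: (@cvg_series_mulrn_cvg0 R[i] a); first exact: cva1.
  rewrite (funext na).
  apply: (@cvgB R[i] R[i]^o); last by apply: (@cvgMl_tmp R[i]); exact: cvu.
  apply: (@cvgB R[i] R[i]^o); apply: (@cvgMl_tmp R[i]); first exact: cvL.
  exact: cva.
have L0 : L = 0.
  by apply/eqP; move/eqP: M0; rewrite !mulr0 !subr0 !mulf_eq0 (negPf y0) pnatr_eq0.
by apply/eqP; rewrite -subr_eq0 -oppr_eq0 opprB -/L L0.
Qed.
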